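(* Let $A_1,A_2,B,C_1,C_2$ be (real or complex) matrices such that all the products $A_i^HBC_j$ exist for $i,j=1,2$. Then, possibly up to zeros, $$\left[S(A_1^HBC_1),\,S(A_2^HBC_2)\right]\prec_w S\left(\sqrt{A_1A_1^H+A_2A_2^H}\;B\,\sqrt{C_1C_1^H+C_2C_2^H}\right),$$ and in the case that $A_i=C_i$ ($i=1,2$) and $B=B^H$, we have, possibly up to zeros, $$\left[\Lambda(A_1^HBA_1),\,\Lambda(A_2^HBA_2)\right]\prec_w\left(\Lambda\left(\sqrt{A_1A_1^H+A_2A_2^H}\;B\,\sqrt{A_1A_1^H+A_2A_2^H}\right)\right)^+.$$
   Context: $M^H$ is the conjugate transpose of $M$, and the square roots are the Hermitian nonnegative definite square roots. $S(M)$ is the vector of all singular values of $M$ in decreasing order. $\Lambda(M)$ is the vector of all eigenvalues (with multiplicity) of $M$, for $M$ with real eigenvalues, in decreasing order. $[a,b]$ denotes concatenation of vectors, and $a^+=\max\{a,0\}$ component-wise. For a real vector $x$, $x^\downarrow$ denotes its rearrangement in decreasing order. For real $n$-vectors, $x\prec_w y$ (weak majorization) means $\sum_{i=1}^k x_i^\downarrow\le\sum_{i=1}^k y_i^\downarrow$ for $k=1,\ldots,n$. ''Possibly up to zeros'' means that zero entries are appended to, or removed from, the vectors if necessary so that their sizes match. *)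

(* Defs.v *)
From HB Require Import structures.
From mathcomp Require Import all_boot all_order all_algebra.
From mathcomp Require Import complex reals.

Set Implicit Arguments.
Unset Strict Implicit.
Unset Printing Implicit Defensive.

Import Order.TTheory GRing.Theory Num.Theory.
Local Open Scope ring_scope.
Local Open Scope sesquilinear_scope.

Section SquareRoot.
Variable C : numClosedFieldType.

Definition psdmx n (P : 'M[C]_n) : Prop :=
  P = P^t* /\ forall x : 'cV[C]_n, 0 <= (x^t* *m P *m x) 0 0.

(* Meaningful for psdmx P only: psd_sqrtmx and sqrtmx_uniq below show that it is
   then the unique nonnegative definite square root of P. *)
Definition sqrtmx n (P : 'M[C]_n) : 'M[C]_n :=
  invmx (spectralmx P) *m diag_mx (map_mx sqrtC (spectral_diag P))
    *m spectralmx P.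

Lemma trmxC_mul m n p (A : 'M[C]_(m, n)) (B : 'M[C]_(n, p)) :
  (A *m B)^t* = B^t* *m A^t*.
Proof. by rewrite trmx_mul map_mxM. Qed.

Lemma psd_gram m n (A : 'M[C]_(m, n)) : psdmx (A *m A^t*).
Proof.
split=> [|x]; first by rewrite trmxC_mul trmxCK.
rewrite mulmxA -mulmxA -[X in X *m (_ *m _)]trmxCK trmxC_mul trmxCK.
rewrite mxE sumr_ge0 // => i _.
by rewrite !mxE mulrC mul_conjC_ge0.
Qed.

Lemma psdD n (P Q : 'M[C]_n) : psdmx P -> psdmx Q -> psdmx (P + Q).
Proof.
move=> [hP pP] [hQ pQ]; split=> [|x].
  by rewrite linearD /= map_mxD -hP -hQ.
by rewrite mulmxDr mulmxDl mxE addr_ge0.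
Qed.

Lemma psd_normal n (P : 'M[C]_n) : psdmx P -> P \is normalmx.
Proof. by move=> [hP _]; apply/normalmxP; rewrite -hP. Qed.

Lemma psd_spectral_ge0 n (P : 'M[C]_n) (i : 'I_n) :
  psdmx P -> 0 <= spectral_diag P 0 i.
Proof.
move=> psdP; have /orthomx_spectralP := psd_normal psdP.
have [_ /(_ (col i ((spectralmx P)^t*)))] := psdP.
set U := spectralmx P; set d := spectral_diag P => + eP.
have uU : U \is unitarymx := spectral_unitarymx P.
have uUt : U *m U^t* = 1%:M by apply/unitarymxP.
rewrite {}eP invmx_unitary // colE trmxC_mul trmxCK !mulmxA.
rewrite -[_ *m U *m _]mulmxA uUt mulmx1 -[_ *m U *m _]mulmxA uUt mulmx1.
rewrite trmx_delta map_delta_mx -rowE -colE !mxE eqxx mulr1n.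
by [].
Qed.

Lemma psd_sqrtmx n (P : 'M[C]_n) :
  psdmx P -> psdmx (sqrtmx P) /\ sqrtmx P *m sqrtmx P = P.
Proof.
move=> psdP; have /orthomx_spectralP eP := psd_normal psdP.
have uU := spectral_unitarymx P.
pose e := map_mx (fun a => sqrtC (sqrtC a)) (spectral_diag P).
split; last first.
  rewrite [RHS]eP /sqrtmx -!mulmxA mulKVmx ?unitarymx_unit //.
  congr (_ *m _); rewrite !mulmxA mulmx_diag; congr (diag_mx _ *m _).
  by apply/rowP=> i; rewrite !mxE -expr2 sqrtCK.
have -> : sqrtmx P =
    (invmx (spectralmx P) *m diag_mx e) *m (invmx (spectralmx P) *m diag_mx e)^t*.
  rewrite /sqrtmx invmx_unitary // trmxC_mul trmxCK.
  rewrite tr_diag_mx map_diag_mx !mulmxA; congr (_ *m _).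
  rewrite -mulmxA mulmx_diag; congr (_ *m diag_mx _).
  apply/rowP=> i; rewrite !mxE.
  have ge0 : 0 <= sqrtC (spectral_diag P 0 i).
    by rewrite sqrtC_ge0 psd_spectral_ge0.
  by rewrite [X in _ * X]geC0_conj -?expr2 ?sqrtCK ?sqrtC_ge0 ?psd_spectral_ge0.
exact: psd_gram.
Qed.

Lemma sqrtmx_uniq n (P X : 'M[C]_n) :
  psdmx P -> psdmx X -> X *m X = P -> X = sqrtmx P.
Proof.
move=> psdP psdX XX; have [psdS SS] := psd_sqrtmx psdP.
move: (sqrtmx P) psdS SS => S psdS; rewrite -{}XX => SS {P psdP}.
have /orthomx_spectralP := psd_normal psdX.
have /orthomx_spectralP := psd_normal psdS.
have := fun i => @psd_spectral_ge0 n S i psdS.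
have := fun i => @psd_spectral_ge0 n X i psdX.
have := spectral_unit S; have := spectral_unit X.
move: (spectralmx X) (spectral_diag X) (spectralmx S) (spectral_diag S).
move=> U d V e uU uV d0 e0 eS eX.
pose W := U *m invmx V.
have h : diag_mx d *m diag_mx d *m W = W *m (diag_mx e *m diag_mx e).
  have : U *m (X *m X) *m invmx V = U *m (S *m S) *m invmx V by rewrite SS.
  by rewrite eS eX /W !mulmxA !mulmxK ?mulmxV ?mul1mx.
have {h} : diag_mx d *m W = W *m diag_mx e.
  move: W h => W h; apply/matrixP=> i j; move/matrixP/(_ i j): h.
  rewrite !mulmx_diag !mul_diag_mx !mul_mx_diag !mxE.
  have [-> | nz] := eqVneq (W i j) 0; first by rewrite !mulr0 !mul0r.
  rewrite [LHS]mulrC => /(mulfI nz) /eqP; rewrite -!expr2 eqrXn2 // => /eqP ->.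
  by rewrite mulrC.
move=> h; rewrite eX eS -mulmxA -[diag_mx d *m U](mulmxKV uV).
rewrite -[diag_mx d *m U *m _]mulmxA -/W h /W.
by rewrite !mulmxA mulVmx ?mul1mx.
Qed.

End SquareRoot.

Section Spectra.
Variable R : realType.

(* The roots of the characteristic polynomial, with multiplicity. *)
Definition eigenvals n (M : 'M[R[i]]_n) : seq R[i] :=
  sval (closed_field_poly_normal (char_poly M)).

Lemma eigenvalsP n (M : 'M[R[i]]_n) :
  char_poly M = \prod_(z <- eigenvals M) ('X - z%:P).
Proof.
rewrite /eigenvals; case: closed_field_poly_normal => r /= {1}->.
by rewrite (monicP (char_poly_monic M)) scale1r.
Qed.

(* Meant for matrices with real eigenvalues, on which Re loses nothing. *)
Definition Lambda n (M : 'M[R[i]]_n) : seq R :=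
  sort >=%R [seq complex.Re z | z <- eigenvals M].

(* Square roots of the eigenvalues of M^H M; when m < n the n - m smallest of
   these n eigenvalues are zeros that do not count as singular values. *)
Definition singvals m n (M : 'M[R[i]]_(m, n)) : seq R :=
  take (minn m n) [seq Num.sqrt a | a <- Lambda (M^t* *m M)].

Definition pospart (x : seq R) : seq R := [seq Num.max a 0 | a <- x].

Definition weak_maj n (x y : n.-tuple R) : Prop :=
  forall k : nat, (1 <= k <= n)%N ->
    \sum_(i < k) (sort >=%R x)`_i <= \sum_(i < k) (sort >=%R y)`_i.

(* x' arises from x by appending or removing zeros; the order of the entries
   is irrelevant to weak_maj. *)
Definition eq_upto0 (x x' : seq R) : bool :=
  perm_eq [seq a <- x | a != 0] [seq a <- x' | a != 0].

(* Holds for every way of matching the sizes by appending or removing zeros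
   (at least one exists). *)
Definition weak_maj_upto0 (x y : seq R) : Prop :=
  forall n (x' y' : n.-tuple R),
    eq_upto0 x x' -> eq_upto0 y y' -> weak_maj x' y'.

End Spectra.

(* Main.v *)
Require Import Defs.
From HB Require Import structures.
From mathcomp Require Import all_boot all_order all_algebra.
From mathcomp Require Import complex reals.

Set Implicit Arguments.
Unset Strict Implicit.
Unset Printing Implicit Defensive.

Import Order.TTheory GRing.Theory Num.Theory.
Local Open Scope ring_scope.
Local Open Scope sesquilinear_scope.

(** For nonnegative [y], [x] is weakly majorized by [y] as soon as the sums of
    [max (a - t) 0] over the entries [a] compare for every [t >= 0]; such sums
    ignore zero entries and positive parts, so padding is harmless.  For
    Hermitian matrices the comparison follows from convexity: in suitable
    orthonormal bases the eigenvalues of the diagonal blocks of G form the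
    diagonal of a matrix unitarily similar to G, hence are doubly stochastic
    averages of the eigenvalues of G.  Apply this to G = A^H B A with
    A = [A1 A2], which shares its nonzero eigenvalues with S B S, where
    S^2 = A A^H.  The singular value inequality is the Hermitian one for the
    dilations [[0, M], [M^H, 0]], whose nonzero eigenvalues are plus and minus
    the nonzero singular values of M. *)

(** * Characteristic polynomials of products and of antidiagonal block matrices *)

Section CharPoly.
Variable K : comNzRingType.

(** Both sides compute a multiple of the determinant of [D]: multiplying [D] on the right by one
    block triangular matrix clears [b], by another clears [a]. The powers of ['X] account for
    rectangular factors. *)
Lemma char_poly_mulmxC m n (A : 'M[K]_(m, n)) (B : 'M[K]_(n, m)) :
  'X^n * char_poly (A *m B) = 'X^m * char_poly (B *m A).
Proof.
pose a := map_mx polyC A; pose b := map_mx polyC B.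
pose D := block_mx ('X%:M : 'M_m) a b (1%:M : 'M_n).
have detAB : \det D = char_poly (A *m B).
  have := congr1 determinant (mulmx_block 'X%:M a b 1%:M 1%:M 0 (- b) 1%:M).
  rewrite !mulmxN !mulmx1 !mulmx0 mul1mx addrN !add0r.
  rewrite det_mulmx det_lblock !det1 !mulr1 -/D => ->.
  by rewrite det_ublock det1 mulr1 /char_poly /char_poly_mx map_mxM.
rewrite -detAB mulrC.
have := congr1 determinant (mulmx_block 'X%:M a b 1%:M 1%:M (- a) 0 'X%:M).
rewrite !mulmx1 !mulmx0 !addr0 !mulmxN mul1mx mul_scalar_mx mul_mx_scalar addNr.
rewrite det_mulmx det_ublock det_lblock det1 mul1r !det_scalar -/D => ->.
by rewrite /char_poly /char_poly_mx map_mxM addrC.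
Qed.

(** One block column operation clears the upper right block and leaves ['X^2 - b a] in the lower
    right one; its determinant is a characteristic polynomial evaluated at ['X^2]. *)
Lemma char_poly_antiblock m n (A : 'M[K]_(m, n)) (B : 'M[K]_(n, m)) :
  'X^n * char_poly (block_mx 0 A B 0) = 'X^m * (char_poly (B *m A) \Po 'X^2).
Proof.
pose a := map_mx polyC A; pose b := map_mx polyC B.
have eD : char_poly_mx (block_mx 0 A B 0) = block_mx 'X%:M (- a) (- b) 'X%:M.
  rewrite /char_poly_mx map_block_mx !map_mx0 scalar_mx_block.
  by rewrite opp_block_mx add_block_mx !oppr0 !addr0 !add0r.
rewrite mulrC /char_poly eD.
have := congr1 determinant
  (mulmx_block 'X%:M (- a) (- b) 'X%:M 1%:M a 0 'X%:M).
rewrite !mulmx1 !mulmx0 !addr0 !mulNmx mul_scalar_mx mul_mx_scalar addrN.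
rewrite det_mulmx det_ublock det_lblock det1 mul1r !det_scalar => ->.
have compE (N : 'M[K]_n) :
    map_mx (comp_poly 'X^2) (char_poly_mx N) = ('X^2)%:M - map_mx polyC N.
  by apply/matrixP=> i j; rewrite !mxE rmorphB rmorphMn /= comp_polyX comp_polyC.
by rewrite -det_map_mx compE -map_mxM -scalar_mxM expr2 addrC.
Qed.

End CharPoly.

(** * Weak majorization through truncated sums *)

Section Majorization.
Variable R : realType.
Implicit Types (t : R) (x y s : seq R).

Definition excess t x : R := \sum_(a <- x) Num.max (a - t) 0.

Lemma excess_cat t x y : excess t (x ++ y) = excess t x + excess t y.
Proof. exact: big_cat. Qed.

Lemma excess0 t : 0 <= t -> Num.max (0 - t) 0 = 0.
Proof. by move=> t0; rewrite sub0r max_r // oppr_le0. Qed.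

Lemma perm_excess t x y : perm_eq x y -> excess t x = excess t y.
Proof. exact: perm_big. Qed.

Lemma excess_eq_upto0 t x y : 0 <= t -> eq_upto0 x y -> excess t x = excess t y.
Proof.
move=> t0; have nz s : excess t s = excess t [seq a <- s | a != 0].
  rewrite /excess big_filter [LHS](bigID (fun a => a != 0)) /=.
  rewrite [X in _ + X]big1 ?addr0 //.
  by move=> a; rewrite negbK => /eqP->; rewrite excess0.
by move=> exy; rewrite nz [RHS]nz; apply: perm_excess.
Qed.

Lemma excess_pospart t x : 0 <= t -> excess t (pospart x) = excess t x.
Proof.
move=> t0; rewrite /excess big_map; apply: eq_bigr => a _.
case: (leP 0 a) => // a0; rewrite excess0 // max_r //.
by rewrite subr_le0 (le_trans (ltW a0)).
Qed.

Lemma sum_le_excess t s k : (k <= size s)%N ->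
  \sum_(i < k) s`_i <= t *+ k + excess t s.
Proof.
move=> ks; rewrite /excess (big_nth 0) (big_cat_nat (leq0n k) ks) /= big_mkord addrA.
have -> : t *+ k = \sum_(i < k) t by rewrite sumr_const card_ord.
rewrite -big_split /=.
rewrite ler_wpDr ?sumr_ge0 // => [i _|]; first by rewrite le_max lexx orbT.
by apply: ler_sum => i _; rewrite -lerBlDl le_max lexx.
Qed.

(** The bound of [sum_le_excess] is attained when [t] is the [k]-th largest entry (index [k.-1]):
    the first [k] entries are at least [t], and the later ones contribute nothing. *)
Lemma sum_sorted_excess s k : (0 < k <= size s)%N -> sorted >=%R s ->
  \sum_(i < k) s`_i = s`_k.-1 *+ k + excess s`_k.-1 s.
Proof.
move=> /andP[k0 ks] ss; set t := s`_k.-1.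
have nths i j : (i <= j < size s)%N -> s`_j <= s`_i.
  move=> /andP[ij js]; apply: (sorted_leq_nth _ _ 0 ss) => //.
  - exact: ge_trans.
  - exact: ge_refl.
  - exact: leq_ltn_trans js.
rewrite /excess (big_nth 0) (big_cat_nat (leq0n k) ks) /= big_mkord addrA.
have -> : t *+ k = \sum_(i < k) t by rewrite sumr_const card_ord.
rewrite -big_split /=.
rewrite big_nat [X in _ + X]big1 ?addr0 => [|i /andP[ki ins]]; last first.
  by rewrite max_r // subr_le0 nths // ins andbT (leq_trans (leq_pred k)).
apply: eq_bigr => i _; rewrite max_l ?subrKC // subr_ge0 nths //.
by rewrite -ltnS prednK // ltn_ord.
Qed.

(* For y nonnegative, the sum of the k largest entries of y equals the minimum
   over t >= 0 of k t + excess t y. *)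
Lemma excess_weak_maj n (x y : n.-tuple R) :
  (forall a, a \in y -> 0 <= a) ->
  (forall t, 0 <= t -> excess t x <= excess t y) -> weak_maj x y.
Proof.
move=> y0 exy k /andP[k0 kn].
rewrite [leRHS]sum_sorted_excess ?size_sort ?size_tuple ?k0 //; last first.
  by apply: sort_sorted; exact: ge_total.
(* The threshold is an entry of [y], hence nonnegative, so the excess hypothesis applies to it. *)
set t := _`_k.-1; have t0 : 0 <= t.
  by rewrite y0 // -(mem_sort >=%R) mem_nth // size_sort size_tuple prednK.
rewrite (le_trans (sum_le_excess t _)) ?size_sort ?size_tuple //.
rewrite lerD2l (perm_excess _ (permEl (perm_sort _ _))).
by rewrite (perm_excess _ (permEl (perm_sort _ _))) exy.
Qed.

Lemma excess_weak_maj_upto0 x y :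
  (forall a, a \in y -> 0 <= a) ->
  (forall t, 0 <= t -> excess t x <= excess t y) -> weak_maj_upto0 x y.
Proof.
move=> y0 exy n x' y' ex ey; apply: excess_weak_maj => [a ay'|t t0].
  have [->//|nz] := eqVneq a 0; apply: y0.
  have : a \in [seq b <- y' | b != 0] by rewrite mem_filter nz.
  by rewrite -(perm_mem ey) mem_filter => /andP[].
by rewrite -(excess_eq_upto0 t0 ex) -(excess_eq_upto0 t0 ey) exy.
Qed.

(** A nonzero entry beyond position [k] would be positive and force the first [k] entries to be
    positive too; the remaining places could then not hold all the zeros. This serves to show that
    the truncation in [singvals] discards only zeros. *)
Lemma sorted_drop_eq0 s k : sorted >=%R s -> (forall a, a \in s -> 0 <= a) ->
  (size s <= k + count_mem 0%R s)%N -> forall a, a \in drop k s -> a = 0.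
Proof.
move=> ss s0 sk a ad; apply/eqP; case: eqVneq => // nz.
have a0 : 0 < a by rewrite lt0r nz s0 // (mem_drop ad).
have ks : (k < size s)%N.
  by rewrite ltnNge; apply/negP => /drop_oversize ds; rewrite ds in ad.
have t0 : count_mem 0 (take k s) = 0%N.
  apply/eqP; rewrite -leqn0 leqNgt -has_count; apply/hasPn => b bt /=.
  move: ss; rewrite -{1}[s](cat_take_drop k) sorted_pairwise; last exact: ge_trans.
  rewrite pairwise_cat => /andP[/allrelP/(_ b a bt ad) ab _].
  by rewrite gt_eqF // (lt_le_trans a0).
have dk : (count_mem 0%R (drop k s) < size (drop k s))%N.
  rewrite ltn_neqAle count_size andbT -all_count; apply/allPn.
  by exists a; rewrite //= .
move: sk; rewrite -{1 2}[s](cat_take_drop k) count_cat t0 add0n size_cat.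
by rewrite (size_takel (ltnW ks)) leq_add2l leqNgt dk.
Qed.

End Majorization.

(** * Eigenvalues of normal and Hermitian matrices, and pinching *)

Section Spectrum.
Variable R : realType.
Local Notation C := R[i].
Implicit Types t : R.

Lemma excess_Lambda t n (M : 'M[C]_n) :
  excess t (Lambda M) = excess t [seq complex.Re z | z <- eigenvals M].
Proof. exact/perm_excess/permEl/perm_sort. Qed.

Lemma prod_nseq0 k :
  \prod_(z <- nseq k (0 : C)) ('X - z%:P) = 'X^k.
Proof. by elim: k => [|k IH]; rewrite ?big_nil // big_cons IH subr0 exprS. Qed.

(** Each factor ['X] contributes one root zero, so both lists are the roots of the same split monic
    polynomial. *)
Lemma eigenvals_perm a b m n (M : 'M[C]_m) (N : 'M[C]_n) :
  'X^a * char_poly M = 'X^b * char_poly N ->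
  perm_eq (nseq a 0 ++ eigenvals M) (nseq b 0 ++ eigenvals N).
Proof.
by move=> e; apply: prod_XsubC_eq; rewrite !big_cat /= !prod_nseq0 -!eigenvalsP.
Qed.

Lemma excess_perm_nseq0 t a b (r s : seq C) : 0 <= t ->
  perm_eq (nseq a 0 ++ r) (nseq b 0 ++ s) ->
  excess t [seq complex.Re z | z <- r] = excess t [seq complex.Re z | z <- s].
Proof.
move=> t0 /(perm_map (@complex.Re R)) /perm_excess e; move: (e t).
have nseq0 k : excess t (nseq k 0) = 0.
  by apply: big1_seq => z /andP[_ /nseqP[-> _]]; rewrite excess0.
by rewrite !map_cat !excess_cat !map_nseq !nseq0 !add0r.
Qed.

Lemma excess_char_poly t a b m n (M : 'M[C]_m) (N : 'M[C]_n) : 0 <= t ->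
  'X^a * char_poly M = 'X^b * char_poly N ->
  excess t (Lambda M) = excess t (Lambda N).
Proof.
move=> t0 /eigenvals_perm e; rewrite !excess_Lambda.
exact: excess_perm_nseq0 e.
Qed.

Lemma eigenvals_normal n (H : 'M[C]_n) : H \is normalmx ->
  perm_eq (eigenvals H) [seq spectral_diag H 0 i | i <- enum 'I_n].
Proof.
move=> /orthomx_spectralP eH; apply: prod_XsubC_eq.
rewrite -eigenvalsP {1}eH big_map big_enum /=.
(* The factor ['X^n] lets [char_poly_mulmxC] move [spectralmx H] to the front, where it cancels its
   inverse. *)
apply: (@mulfI _ 'X^n); first by rewrite expf_neq0 ?polyX_eq0.
rewrite char_poly_mulmxC mulKVmx ?spectral_unit //.
rewrite char_poly_trig ?diag_mx_is_trig //; congr (_ * _).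
by apply: eq_bigr => i _; rewrite mxE eqxx.
Qed.

Lemma excess_Lambda_normal t n (H : 'M[C]_n) : H \is normalmx ->
  excess t (Lambda H) =
  \sum_i Num.max (complex.Re (spectral_diag H 0 i) - t) 0.
Proof.
move=> nH; rewrite excess_Lambda.
rewrite (perm_excess _ (perm_map _ (eigenvals_normal nH))) /excess.
by rewrite 2!big_map big_enum.
Qed.

(* Schur: the diagonal of a normal matrix arises from its eigenvalues by a
   doubly stochastic matrix, here |u_ki|^2. *)
Lemma excess_diag_le t n (H : 'M[C]_n) : H \is normalmx ->
  \sum_i Num.max (complex.Re (H i i) - t) 0 <= excess t (Lambda H).
Proof.
move=> nH; rewrite excess_Lambda_normal //.
set d := spectral_diag H; pose U := spectralmx H.
have uU : U \is unitarymx := spectral_unitarymx H.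
have UU : U *m U^t* = 1%:M by apply/unitarymxP.
have UU' : U^t* *m U = 1%:M by apply: mulmx1C.
pose w k i := complex.Re (`|U k i| ^+ 2).
have wE k i : (w k i)%:C%C = `|U k i| ^+ 2 by rewrite RRe_real ?rpredX ?normr_real.
have w0 k i : 0 <= w k i by rewrite -lecR wE exprn_ge0.
have row1 k : \sum_i w k i = 1.
  apply: complexI; rewrite rmorph_sum rmorph1 /=.
  have /matrixP/(_ k k) := UU; rewrite !mxE eqxx mulr1n => <-.
  by apply: eq_bigr => i _; rewrite wE !mxE normCK.
have col1 i : \sum_k w k i = 1.
  apply: complexI; rewrite rmorph_sum rmorph1 /=.
  have /matrixP/(_ i i) := UU'; rewrite !mxE eqxx mulr1n => <-.
  by apply: eq_bigr => k _; rewrite wE !mxE normCKC.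
have Hii i : complex.Re (H i i) = \sum_k w k i * complex.Re (d 0 k).
  have /orthomx_spectralP -> := nH; rewrite invmx_unitary // mxE.
  rewrite (big_morph (@complex.Re R) (id1 := 0) (op1 := +%R)) //; last by case=> ? ? [].
  apply: eq_bigr => k _; rewrite mul_mx_diag !mxE.
  rewrite mulrAC -normCKC -wE /=.
  by case: (d 0 k) => x y /=; rewrite mul0r subr0.
(* Jensen's inequality for the convex function [Num.max (a - t) 0] of [a], with weights [w k i]
   summing to one by [col1]. *)
have step i : Num.max (complex.Re (H i i) - t) 0 <=
    \sum_k w k i * Num.max (complex.Re (d 0 k) - t) 0.
  rewrite ge_max; apply/andP; split; last first.
    by apply: sumr_ge0 => k _; rewrite mulr_ge0 // le_max lexx orbT.
  have -> : complex.Re (H i i) - t = \sum_k w k i * (complex.Re (d 0 k) - t).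
    under eq_bigr do rewrite mulrBr.
    by rewrite Hii sumrB -mulr_suml col1 mul1r.
  by apply: ler_sum => k _; apply: ler_wpM2l; rewrite ?le_max ?lexx.
(* After exchanging the sums, each eigenvalue has total weight one by [row1]. *)
rewrite (le_trans (ler_sum _ (fun i _ => step i))) // exchange_big /=.
by apply: ler_sum => k _; rewrite -mulr_suml row1 mul1r.
Qed.

Lemma hermitian_normal n (H : 'M[C]_n) : H = H^t* -> H \is normalmx.
Proof. by move=> hH; apply/normalmxP; rewrite -hH. Qed.

Lemma trmxC_block m1 m2 n1 n2 (P : 'M[C]_(m1, n1)) (Q : 'M[C]_(m1, n2))
    (S : 'M[C]_(m2, n1)) (T : 'M[C]_(m2, n2)) :
  (block_mx P Q S T)^t* = block_mx (P^t*) (S^t*) (Q^t*) (T^t*).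
Proof. by rewrite tr_block_mx map_block_mx. Qed.

Lemma excess_unitary t n (W G : 'M[C]_n) : 0 <= t -> W *m W^t* = 1%:M ->
  excess t (Lambda (W *m G *m W^t*)) = excess t (Lambda G).
Proof.
move=> t0 uW; have := char_poly_mulmxC (W *m G) (W^t*).
rewrite mulmxA (mulmx1C uW) mul1mx; exact: excess_char_poly.
Qed.

Lemma excess_pinching t n1 n2 (G11 : 'M[C]_n1) (G12 : 'M[C]_(n1, n2))
    (G21 : 'M[C]_(n2, n1)) (G22 : 'M[C]_n2) (G := block_mx G11 G12 G21 G22) :
  0 <= t -> G = G^t* ->
  excess t (Lambda G11) + excess t (Lambda G22) <= excess t (Lambda G).
Proof.
move=> t0 hG.
have [h1 _ _ h2] : [/\ G11 = G11^t*, G12 = G21^t*, G21 = G12^t* & G22 = G22^t*].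
  by move: hG; rewrite trmxC_block => /eq_block_mx[].
have diagE n (H : 'M[C]_n) : H = H^t* -> let V := spectralmx H in
    excess t (Lambda H) =
    \sum_i Num.max (complex.Re ((V *m H *m V^t*) i i) - t) 0.
  move=> /hermitian_normal nH V.
  have uV : V \is unitarymx := spectral_unitarymx H.
  rewrite excess_Lambda_normal //.
  apply: eq_bigr => i _; have /orthomx_spectralP {2}-> := nH.
  rewrite -/V !mulmxA mulmxV ?unitarymx_unit // mul1mx.
  by rewrite mulmxtVK // mxE eqxx.
rewrite (diagE _ _ h1) (diagE _ _ h2).
set V1 := spectralmx G11; set V2 := spectralmx G22.
(* [W] diagonalizes both diagonal blocks of [G] at once, so the diagonal of [W *m G *m W^t*] lists
   their eigenvalues, whatever becomes of the off-diagonal blocks. *)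
pose W := block_mx V1 0 0 V2.
have uW : W *m W^t* = 1%:M.
  rewrite trmxC_block mulmx_block !trmx0 !map_mx0 !mulmx0 !mul0mx !addr0 !add0r.
  by rewrite !(unitarymxP (spectral_unitarymx _)) -scalar_mx_block.
rewrite -(excess_unitary G t0 uW).
apply: le_trans (excess_diag_le _ (hermitian_normal _)); last first.
  by rewrite !trmxC_mul trmxCK -hG mulmxA.
rewrite big_split_ord /= /W /G trmxC_block !mulmx_block !trmx0 !map_mx0.
rewrite !mulmx0 !mul0mx !addr0 !add0r.
by rewrite lerD // ler_sum // => i _; rewrite ?block_mxEul ?block_mxEdr.
Qed.

(* With A = [A1 A2], the matrices A^H B A, B (A A^H) = B S S and S B S have the
   same eigenvalues up to zeros. *)
Lemma excess_congruence t m p1 p2 (A1 : 'M[C]_(m, p1)) (A2 : 'M[C]_(m, p2))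
    (B S : 'M[C]_m) :
  0 <= t -> B = B^t* -> S *m S = A1 *m A1^t* + A2 *m A2^t* ->
  excess t (Lambda (A1^t* *m B *m A1)) + excess t (Lambda (A2^t* *m B *m A2))
    <= excess t (Lambda (S *m B *m S)).
Proof.
move=> t0 hB SS; pose A := row_mx A1 A2.
have eA : A^t* = col_mx (A1^t*) (A2^t*) by rewrite tr_row_mx map_col_mx.
have <- : excess t (Lambda (A^t* *m B *m A)) = excess t (Lambda (S *m B *m S)).
  (* Cyclic shifts lead both matrices to [S *m S *m B]; for the square factors the powers of ['X]
     are equal and cancel. *)
  have /mulfI eSBS := char_poly_mulmxC (S *m B) S.
  have := char_poly_mulmxC A (A^t* *m B).
  rewrite mulmxA {1}eA {1}/A mul_row_col -SS -[S *m S *m B]mulmxA -eSBS; last first.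
    by rewrite expf_neq0 ?polyX_eq0.
  by move/esym/excess_char_poly=> ->.
have hG : A^t* *m B *m A = (A^t* *m B *m A)^t*.
  by rewrite !trmxC_mul trmxCK -hB mulmxA.
move: hG; rewrite eA mul_col_mx mul_col_row; exact: excess_pinching.
Qed.

(** * Singular values and Hermitian dilations *)

Definition dilation m n (M : 'M[C]_(m, n)) : 'M[C]_(m + n) :=
  block_mx 0 M (M^t*) 0.

Lemma eigenvals_gram_ge0 m n (M : 'M[C]_(m, n)) z :
  z \in eigenvals (M^t* *m M) -> 0 <= z.
Proof.
have psdN : psdmx (M^t* *m M) by rewrite -{2}[M]trmxCK; apply: psd_gram.
rewrite (perm_mem (eigenvals_normal (psd_normal psdN))) => /mapP[i _ ->].
exact: psd_spectral_ge0.
Qed.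

Lemma size_eigenvals n (M : 'M[C]_n) : size (eigenvals M) = n.
Proof.
by apply: succn_inj; rewrite -(size_char_poly M) eigenvalsP size_prod_XsubC.
Qed.

Lemma excess_singvals t m n (M : 'M[C]_(m, n)) : 0 <= t ->
  excess t (singvals M) =
  \sum_(z <- eigenvals (M^t* *m M)) Num.max (Num.sqrt (complex.Re z) - t) 0.
Proof.
move=> t0; set N := M^t* *m M; set s := [seq Num.sqrt a | a <- Lambda N].
have -> : \sum_(z <- eigenvals N) Num.max (Num.sqrt (complex.Re z) - t) 0
    = excess t s.
  by rewrite /excess big_map (perm_big _ (permEl (perm_sort _ _))) big_map.
have sz : size s = n by rewrite !(size_map, size_sort) size_eigenvals.
rewrite /singvals -/N -/s -[in RHS](cat_take_drop (minn m n) s) excess_cat.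
rewrite [X in _ + X]big1_seq ?addr0 // => a /andP[_ ad].
suff -> : a = 0 by rewrite excess0.
apply: sorted_drop_eq0 ad.
- apply: (homo_sorted (e := >=%R)) => [x y|]; first exact: ler_wsqrtr.
  by apply: sort_sorted; exact: ge_total.
- by move=> b /mapP[? _ ->]; exact: sqrtr_ge0.
rewrite sz; case: (leqP n m) => [nm|mn]; first by rewrite leq_addr.
(* For [m < n], comparing the zeros of the spectra of [M *m M^t*] and [N] shows that [N] has at
   least [n - m] zero eigenvalues. *)
have /permP/(_ (pred1 0)) := eigenvals_perm (char_poly_mulmxC M (M^t*)).
rewrite !count_cat !count_nseq /= eqxx !mul1n -/N => cnt.
have le_cnt : (count_mem 0%R (eigenvals N) <= count_mem 0%R s)%N.
  rewrite !count_map (permP (permEl (perm_sort _ _))) count_map.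
  by apply: sub_count => z /= /eqP->; rewrite sqrtr0.
by rewrite (leq_trans _ (leq_add (leqnn m) le_cnt)) // -cnt leq_addr.
Qed.

(** Each eigenvalue [z] of the Gram matrix is the square of [sg z], so its factor at ['X^2] splits
    into the roots [sg z] and [- sg z]; the latter are at most zero and add nothing to the
    excess. *)
Lemma excess_dilation t m n (M : 'M[C]_(m, n)) : 0 <= t ->
  excess t (Lambda (dilation M)) = excess t (singvals M).
Proof.
move=> t0; rewrite excess_singvals // excess_Lambda; set N := M^t* *m M.
pose sg (z : C) := (Num.sqrt (complex.Re z))%:C%C.
have e : perm_eq (nseq n 0 ++ eigenvals (dilation M))
    (nseq m 0 ++ [seq sg z | z <- eigenvals N] ++ [seq - sg z | z <- eigenvals N]).
  apply: prod_XsubC_eq; rewrite !big_cat /= !prod_nseq0 -eigenvalsP.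
  rewrite char_poly_antiblock -/N eigenvalsP rmorph_prod /= !big_map -big_split.
  congr (_ * _); rewrite !big_seq; apply: eq_bigr => z /eigenvals_gram_ge0 z0.
  have {1}-> : z = sg z ^+ 2.
    rewrite -rmorphXn /= sqr_sqrtr ?RRe_real ?ger0_real //.
    by rewrite -lecR RRe_real ?ger0_real.
  rewrite rmorphB /= comp_polyX comp_polyC polyCN opprK -subr_sqr.
  by rewrite rmorphXn.
rewrite (excess_perm_nseq0 t0 e) /excess !big_map big_cat /= !big_map.
rewrite [X in _ + X]big1 ?addr0 // => z _.
by rewrite max_r //= -opprD oppr_le0 addr_ge0 // sqrtr_ge0.
Qed.

End Spectrum.

Theorem theorem4p5 (R : realType) :
  (forall (m n p1 p2 q1 q2 : nat)
      (A1 : 'M[R[i]]_(m, p1)) (A2 : 'M[R[i]]_(m, p2)) (B : 'M[R[i]]_(m, n))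
      (C1 : 'M[R[i]]_(n, q1)) (C2 : 'M[R[i]]_(n, q2)),
    weak_maj_upto0
      (singvals (A1^t* *m B *m C1) ++ singvals (A2^t* *m B *m C2))
      (singvals (sqrtmx (A1 *m A1^t* + A2 *m A2^t*) *m B
                   *m sqrtmx (C1 *m C1^t* + C2 *m C2^t*))))
  /\
  (forall (m p1 p2 : nat)
      (A1 : 'M[R[i]]_(m, p1)) (A2 : 'M[R[i]]_(m, p2)) (B : 'M[R[i]]_m),
    B = B^t* ->
    weak_maj_upto0
      (Lambda (A1^t* *m B *m A1) ++ Lambda (A2^t* *m B *m A2))
      (pospart (Lambda (sqrtmx (A1 *m A1^t* + A2 *m A2^t*) *m B
                          *m sqrtmx (A1 *m A1^t* + A2 *m A2^t*))))).
Proof.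
split=> [m n p1 p2 q1 q2 A1 A2 B C1 C2|m p1 p2 A1 A2 B hB].
  apply: excess_weak_maj_upto0 => [a /mem_take/mapP[b _ ->]|t t0].
    exact: sqrtr_ge0.
  have [[hS _] SS] := psd_sqrtmx (psdD (psd_gram A1) (psd_gram A2)).
  have [[hT _] TT] := psd_sqrtmx (psdD (psd_gram C1) (psd_gram C2)).
  set S := sqrtmx (A1 *m _ + _) in hS SS *.
  set T := sqrtmx (C1 *m _ + _) in hT TT *.
  rewrite excess_cat -!excess_dilation //.
  (* The two-sided product becomes a congruence of [dilation B] by a block diagonal matrix, the form
     needed for the Hermitian comparison. *)
  have dilE k1 k2 (P : 'M[R[i]]_(m, k1)) (Q : 'M[R[i]]_(n, k2)) :
      dilation (P^t* *m B *m Q) =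
      (block_mx P 0 0 Q)^t* *m dilation B *m block_mx P 0 0 Q.
    rewrite /dilation trmxC_block !mulmx_block !trmx0 !map_mx0.
    rewrite !(mulmx0, mul0mx, addr0, add0r).
    by rewrite !trmxC_mul trmxCK mulmxA.
  (* Since [S] is Hermitian, [dilE] covers the right-hand side as well. *)
  have -> : S *m B *m T = S^t* *m B *m T by rewrite -hS.
  rewrite !dilE [X in _ <= excess _ (Lambda (X *m _ *m _))]trmxC_block -hS -hT !trmx0 !map_mx0.
  apply: excess_congruence => //.
    by rewrite /dilation trmxC_block !trmx0 !map_mx0 trmxCK.
  (* The square of [block_mx S 0 0 T] is the sum of the two block diagonal Gram matrices, because
     [S] and [T] are the respective square roots. *)
  rewrite !trmxC_block !mulmx_block !trmx0 !map_mx0.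
  rewrite !(mulmx0, mul0mx, addr0, add0r) SS TT.
  by rewrite add_block_mx !addr0.
apply: excess_weak_maj_upto0 => [a /mapP[b _ ->]|t t0].
  by rewrite le_max lexx orbT.
rewrite excess_cat excess_pospart // excess_congruence //.
by have [] := psd_sqrtmx (psdD (psd_gram A1) (psd_gram A2)).
Qed.
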